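(* Let $V$ and $W$ be finite-dimensional vector spaces over $\mathbb{F}_2$, let $q : V \to W$ be a regular quadratic map with $\langle b_q(V\times V)\rangle = W$, and let $G$ be the special $2$-group associated with $q$, so that $V = G/Z(G)$ and $W = Z(G)$. Then $G$ is strongly real if and only if for every nonzero $v \in V$ there exists $a \in V$ with $a \neq v$ and $q(a) = q(a-v) = 0$.
   Context: $\mathbb{F}_2$ is the field with two elements. A map $q: V\to W$ of $\mathbb{F}_2$-vector spaces is a quadratic map if $q(\alpha v)=\alpha^2 q(v)$ for all $\alpha\in\mathbb{F}_2$, $v \in V$, and $b_q(v,w) := q(v+w)-q(v)-q(w)$ is bilinear (the polar map). It is regular if $\{w\in V : b_q(v,w)=0 \text{ for all } v\in V\}=0$. $\langle b_q(V\times V)\rangle$ is the subgroup of $W$ generated by the image of $b_q$. A finite $2$-group $G$ is special if it is non-commutative and $G' = \Phi(G) = Z(G) = \Omega(Z(G))$, where $G'=[G,G]$, $\Phi(G)$ is the Frattini subgroup, and $\Omega(H)=\langle x\in H : x^2=1\rangle$. The special $2$-group $G$ associated with $q$ is the special $2$-group (unique up to isomorphism) with identifications (group isomorphisms) $G/Z(G)\cong V$ and $Z(G)\cong W$ under which $q$ is the map $xZ(G)\mapsto x^2$; then $b_q$ corresponds to the commutator map $(xZ(G),yZ(G))\mapsto xyx^{-1}y^{-1}$. An element of a group is strongly real if it is a product of two elements each equal to its own inverse (i.e. elements $y$ with $y^2=1$, the identity allowed); equivalently, $x$ is strongly real if there is $y \in G$ with $y^2=1$ and $y^{-1}xy=x^{-1}$.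 A group is strongly real if all its elements are. *)

(* Defs.v *)
From mathcomp Require Import all_boot all_order all_algebra.
From mathcomp Require Import all_fingroup all_solvable all_field.

Set Implicit Arguments.
Unset Strict Implicit.
Unset Printing Implicit Defensive.

Import GRing.Theory.
Local Open Scope ring_scope.

Definition polar (V W : zmodType) (q : V -> W) (v w : V) : W :=
  q (v + w) - q v - q w.

Definition quadratic_map (V W : lmodType 'F_2) (q : V -> W) : Prop :=
  (forall (a : 'F_2) (v : V), q (a *: v) = a ^+ 2 *: q v) /\
  bilinear_for *:%R *:%R (polar q).

Definition regular_map (V W : zmodType) (q : V -> W) : Prop :=
  forall w : V, (forall v : V, polar q v w = 0) -> w = 0.

(* The subgroup generated by the values of the polar map is the intersection
   of the subgroups containing them; it is W iff each such subgroup is W. *)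
Definition polar_generates (V W : zmodType) (q : V -> W) : Prop :=
  forall S : {pred W}, zmod_closed S ->
    (forall v w : V, polar q v w \in S) -> forall u : W, u \in S.

Definition special_2group (gT : finGroupType) (G : {group gT}) : Prop :=
  [/\ (2.-group G)%g, ~~ abelian G,
      G^`(1)%g = 'Phi(G)%g, 'Phi(G)%g = 'Z(G)%g
    & 'Z(G)%g = <<[set x in 'Z(G) | x ^+ 2 == 1]>>%g].

(* Isomorphisms from a multiplicative finite group onto an additive group;
   isom is not used because a vectType is not a finGroupType. *)
Definition additive_iso (gT : finGroupType) (A : {group gT}) (U : zmodType)
    (f : gT -> U) : Prop :=
  [/\ {in A &, {morph f : x y / (x * y)%g >-> x + y}},
      {in A &, injective f}
    & forall u : U, exists2 x, x \in A & f x = u].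

Definition special_2group_of (V W : lmodType 'F_2) (q : V -> W)
    (gT : finGroupType) (G : {group gT}) : Prop :=
  special_2group G /\
  exists (iV : coset_of 'Z(G)%g -> V) (iW : gT -> W),
    [/\ additive_iso (G / 'Z(G))%G iV,
        additive_iso 'Z(G)%G iW
      & {in G, forall x, q (iV (coset 'Z(G)%g x)) = iW (x ^+ 2)%g}].

Definition strongly_real_elt (gT : finGroupType) (G : {group gT}) (x : gT)
    : Prop :=
  exists y z : gT,
    [/\ y \in G, z \in G, y^-1%g = y, z^-1%g = z & x = (y * z)%g].

Definition strongly_real (gT : finGroupType) (G : {group gT}) : Prop :=
  forall x, x \in G -> strongly_real_elt G x.

(* Main.v *)
(* An element y of G squares to 1 iff q kills its image in V, so writing
   x = y z with involutions y, z amounts to writing the image v of x as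
   a + (v - a) with q a = q (v - a) = 0.  The case a = v is harmless: then
   q v = 0 and a may be replaced by 0. *)
Require Import Defs.
From mathcomp Require Import all_boot all_order all_algebra.
From mathcomp Require Import all_fingroup all_solvable all_field.
Import GRing.Theory.
Local Open Scope ring_scope.

Lemma quadratic_map0 (V W : lmodType 'F_2) (q : V -> W) :
  quadratic_map q -> q 0 = 0.
Proof. by case=> qZ _; rewrite -(scale0r 0) qZ expr0n scale0r. Qed.

Lemma quadratic_mapN (V W : lmodType 'F_2) (q : V -> W) (v : V) :
  quadratic_map q -> q (- v) = q v.
Proof. by case=> qZ _; rewrite -scaleN1r qZ sqrrN expr1n scale1r. Qed.

Lemma additive_iso1 (gT : finGroupType) (A : {group gT}) (U : zmodType)
    (f : gT -> U) : additive_iso A f -> f 1%g = 0.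
Proof.
by case=> fM _ _; apply: (addrI (f 1%g)); rewrite -fM // mulg1 addr0.
Qed.

(** The map [f] is [iV] after the projection of [G] onto [G / 'Z(G)]. As [q (f x)] is [iW (x ^+ 2)]
    and [iW] is injective on the centre, [q] vanishes at [f x] exactly when [x ^+ 2] is trivial. *)
Lemma special_2group_of_sqr (V W : lmodType 'F_2) (q : V -> W)
    (gT : finGroupType) (G : {group gT}) :
  special_2group_of q G ->
  exists f : gT -> V,
    [/\ {in G &, {morph f : x y / (x * y)%g >-> x + y}},
        forall v : V, exists2 x, x \in G & f x = v
      & {in G, forall x, q (f x) = 0 <-> x^-1%g = x}].
Proof.
case=> [[pG _ _ PhiG _] [iV [iW [isoV isoW qE]]]].
have [iVM _ iV_surj] := isoV; have [_ iW_inj _] := isoW.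
have nZ : {subset G <= 'N('Z(G))%g} by apply/subsetP/normal_norm/center_normal.
have inQ x : x \in G -> coset 'Z(G)%g x \in (G / 'Z(G))%g.
  by move=> Gx; apply: mem_quotient.
exists (fun x => iV (coset 'Z(G)%g x)); split.
- by move=> x y Gx Gy; rewrite morphM ?nZ // iVM ?inQ.
- move=> v; have [xZ + <-] := iV_surj v.
  by case/morphimP=> x _ Gx ->; exists x.
move=> x Gx /=; rewrite qE //.
(* Injectivity of [iW] is known only on ['Z(G)]. Squares lie there because ['Phi(G) = 'Z(G)] and the
   Frattini subgroup of a 2-group is generated by commutators and squares. *)
have Zx2 : (x ^+ 2)%g \in 'Z(G)%g.
  rewrite -PhiG (Phi_joing pG) (subsetP (joing_subr _ _)) //.
  by rewrite (Mho_p_elt 1) // (mem_p_elt pG).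
rewrite -(additive_iso1 _ _ _ _ isoW); split.
  by move/iW_inj => /(_ Zx2 (group1 _)) x2; apply/eqP; rewrite eq_invg_mul -x2.
by move/eqP; rewrite eq_invg_mul => /eqP x2; rewrite expgS expg1 x2.
Qed.

Theorem theorem2p5 (V W : vectType 'F_2) (q : V -> W)
    (q_quad : quadratic_map q) (q_reg : regular_map q)
    (q_gen : polar_generates q)
    (gT : finGroupType) (G : {group gT}) (Gq : special_2group_of q G) :
  strongly_real G <->
  (forall v : V, v != 0 ->
     exists a : V, [/\ a != v, q a = 0 & q (a - v) = 0]).
Proof.
have [f [fM f_surj fE]] := special_2group_of_sqr _ _ _ _ _ Gq.
have q0 := quadratic_map0 _ _ _ q_quad.
split=> [realG v nz_v | realq x Gx].
  have [x Gx fx] := f_surj v.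
  have [y [z [Gy Gz /(fE _ Gy) qy /(fE _ Gz) qz def_x]]] := realG x Gx.
  have def_v : v = f y + f z by rewrite -fx def_x fM.
  have [eq_yv | ne_yv] := eqVneq (f y) v.
    by exists 0; split; rewrite // 1?eq_sym // sub0r quadratic_mapN // -eq_yv.
  (* Here [f y - v] is [- f z], and [q] is even. *)
  by exists (f y); rewrite {2}def_v opprD addNKr quadratic_mapN.
(* The hypothesis [realq] omits the zero vector, for which [a = 0] serves. *)
have [a [qa qav]] : exists a, q a = 0 /\ q (a - f x) = 0.
  have [-> | /realq[a [_ qa qav]]] := eqVneq (f x) 0; last by exists a.
  by exists 0; rewrite subr0.
(* Any lift [y] of [a] will do, since by [fE] whether [y] is its own inverse depends only on [f y];
   the other factor must then be [y^-1 * x], lying over [f x - a]. *)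
have [y Gy fy] := f_surj a.
have Gz : (y^-1 * x)%g \in G by rewrite groupM ?groupV.
exists y, (y^-1 * x)%g; split; rewrite ?mulKVg //; first by apply/fE; rewrite ?fy.
apply/fE => //; rewrite -quadratic_mapN //; move: qav.
have -> : f x = a + f (y^-1 * x)%g by rewrite -fy -fM // mulKVg.
by rewrite opprD addNKr.
Qed.
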